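(* Let $k$ be a field, $V=k[t,t^{-1}]$ and $e_n=t^n$ for $n\in\mathbb Z$. For all $a,b\in\mathbb Z$, the coefficient formula $$\{\!\{e_a,e_b\}\!\}_0=\sum_{r\in\mathbb Z}e_r\otimes R_0(E_{ar})(e_b)$$ is a finite sum (only finitely many summands are nonzero) and gives exactly the double bracket $$\{\!\{e_a,e_b\}\!\}_0=\begin{cases}\displaystyle\sum_{j=a}^{b-1}e_j\otimes e_{a+b-1-j}, & a<b,\\[1em] \displaystyle-\sum_{j=b}^{a-1}e_j\otimes e_{a+b-1-j}, & a>b,\\[1em] 0,& a=b.\end{cases}$$
   Context: $k$ is a field and $V=k[t,t^{-1}]$ has basis $e_n=t^n$, $n\in\mathbb Z$. For $i,j\in\mathbb Z$, $E_{ij}\in\operatorname{End}(V)$ is the matrix unit $E_{ij}(e_m)=\delta_{jm}e_i$. Let $I_{\mathbb Z}=\operatorname{Span}_k\{E_{ij}: i,j\in\mathbb Z\}$ be the finitary matrix algebra, and let $\operatorname{End}_{\mathrm{rcf}}(V)$ be the algebra of $\mathbb Z\times\mathbb Z$ matrices having only finitely many nonzero entries in every row and every column (acting on $V$ in the basis $(e_n)$). The linear map $R_0\colon I_{\mathbb Z}\to\operatorname{End}_{\mathrm{rcf}}(V)$ is defined on matrix units by $$R_0(E_{ij})=\begin{cases}\displaystyle-\sum_{p\ge0}E_{i-1-p,j-p}, & i>j,\\[0.8em] \displaystyle\sum_{p\ge0}E_{i+p,j+1+p}, & i\le j,\end{cases}$$ where the infinite sums are understood pointwise: applied to a fixed basis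 vector, at most one summand acts nontrivially. *)

(* Defs.v *)
From HB Require Import structures.
From mathcomp Require Import all_boot all_order all_algebra finmap.
From mathcomp Require Import boolp classical_sets functions cardinality fsbigop.
From mathcomp.multinomials Require Import monalg.
From mathcomp Require Import zify.

Set Implicit Arguments.
Unset Strict Implicit.
Unset Printing Implicit Defensive.

Import Order.TTheory GRing.Theory Num.Theory.

Local Open Scope classical_set_scope.
Local Open Scope ring_scope.

(* The sums [\sum_(i \in A) _] below are 0 by convention when their support   *)
(* is infinite. The lemmas [finite_tens], [finite_R0_unit] and [finite_R0]    *)
(* show that the sums defining [tens], [R0_unit] and [R0] never reach this    *)
(* case. Finiteness of the sum defining [bracket0] is not assumed and has to  *)
(* be proved wherever it is needed.                                           *)
Lemma fsum_coeff_linear (k : fieldType) (U W : lmodType k) (I : choiceType)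
    (c : I -> U -> k) (w : I -> W) :
  (forall i a u v, c i (a *: u + v) = a * c i u + c i v) ->
  (forall u, finite_set [set i | c i u != 0]) ->
  linear (fun u => \sum_(i \in [set: I]) c i u *: w i).
Proof.
move=> clin cfin a u v.
pose D := [set i | c i u != 0] `|` [set i | c i v != 0].
have Dfin : finite_set D by rewrite finite_setU; split; apply: cfin.
have wid x : [set i | c i x != 0] `<=` D ->
    \sum_(i \in [set: I]) c i x *: w i = \sum_(i \in D) c i x *: w i.
  move=> sD; apply/esym/fsbig_widen => // i [_ /= nD].
  have [->|ci] := eqVneq (c i x) 0; first by rewrite scale0r.
  by case: nD; apply: sD.
rewrite !wid; first last.
- move=> i /= ci; have [ui|] := eqVneq (c i u) 0; last by left.
  right => /=; apply: contra ci => /eqP vi.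
  by rewrite clin ui vi mulr0 addr0.
- by move=> i /= ?; left.
- by move=> i /= ?; right.
rewrite !(fsbig_finite _ _ Dfin)/= scaler_sumr -big_split /=.
by apply: eq_bigr => i _; rewrite clin scalerDl scalerA.
Qed.

Lemma fsum_delta (k : fieldType) (W : lmodType k) (I : choiceType)
    (c : I -> k) (w : I -> W) (i0 : I) :
  (forall i, c i = (i == i0)%:R) -> \sum_(i \in [set: I]) c i *: w i = w i0.
Proof.
move=> cE; rewrite (@fsbigTE _ _ _ _ [fset i0]%fset) => [|i].
  by rewrite big_seq_fset1 cE eqxx scale1r.
by rewrite inE => /negbTE i0E; rewrite cE i0E scale0r.
Qed.

(* k[t, t^-1] as a vector space with basis t^n; the multiplication of Laurent *)
(* polynomials plays no role here.                                            *)
Notation laurent k := {malg k[int]}.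

(* V (x) V, realised as the space with basis e_i (x) e_j, (i, j) in Z^2; see  *)
(* [tens_universal].                                                          *)
Notation laurent2 k := {malg k[(int * int)%type]}.

Section Basis.
Variable k : fieldType.
Local Notation V := (laurent k).

Definition e (n : int) : V := mkmalgU n 1.

Lemma coef_e m n : mcoeff m (e n) = (m == n)%:R.
Proof. by rewrite mcoeffU eq_sym. Qed.

Lemma coefP (I : choiceType) (u v : {malg k[I]}) a i :
  mcoeff i (a *: u + v) = a * mcoeff i u + mcoeff i v.
Proof. by rewrite mcoeffD mcoeffZ. Qed.

Lemma finite_coef (I : choiceType) (v : {malg k[I]}) :
  finite_set [set n | mcoeff n v != 0].
Proof.
apply: (@sub_finite_set _ _ [set` msupp v]) => //.
by move=> n /=; rewrite mcoeff_neq0.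
Qed.

Definition tens (u v : V) : laurent2 k :=
  \sum_(p \in [set: int * int])
    (mcoeff p.1 u * mcoeff p.2 v) *: (mkmalgU p 1 : laurent2 k).

Lemma finite_tens (u v : V) :
  finite_set [set p : int * int | mcoeff p.1 u * mcoeff p.2 v != 0].
Proof.
apply: (@sub_finite_set _ _
  ([set i | mcoeff i u != 0] `*` [set j | mcoeff j v != 0])).
  by move=> [i j] /=; rewrite mulf_eq0 negb_or => /andP[].
by apply: finite_setX; apply: finite_coef.
Qed.

Lemma lin_coef (I : choiceType) (W : lmodType k) (f : {malg k[I]} -> W) v :
  linear f ->
  f v = \sum_(n \in [set: I]) mcoeff n v *: f (mkmalgU n 1).
Proof.
move=> flin; pose F := HB.pack_for {linear {malg k[I]} -> W} f
  (GRing.isLinear.Build k {malg k[I]} W *:%R f flin).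
rewrite (@fsbigTE _ _ _ _ (msupp v)) => [|n]; last first.
  by rewrite -mcoeff_eq0 => /eqP ->; rewrite scale0r.
rewrite {1}(monalgE v) -[f]/(F : _ -> _) linear_sum; apply: eq_bigr => n _.
rewrite -linearZ; congr (F _).
by apply/malgP => m; rewrite mcoeffZ !mcoeffU mulr_natr.
Qed.

Lemma tens_linearl v : linear (tens^~ v).
Proof.
apply: fsum_coeff_linear => [p a x y|u]; last exact: finite_tens.
by rewrite coefP mulrDl mulrA.
Qed.

Lemma tens_linearr u : linear (tens u).
Proof.
apply: fsum_coeff_linear => [p a x y|v]; last exact: finite_tens.
by rewrite coefP mulrDr mulrCA.
Qed.

Lemma tens_e i j : tens (e i) (e j) = mkmalgU (i, j) 1.
Proof.
rewrite /tens (@fsum_delta _ _ _ _ _ (i, j)) // => -[m n].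
by rewrite !coef_e -natrM mulnb.
Qed.

Lemma tens_universal (W : lmodType k) (f : V -> V -> W) :
  (forall v, linear (f^~ v)) -> (forall u, linear (f u)) ->
  exists g : laurent2 k -> W,
    [/\ linear g, forall u v, g (tens u v) = f u v
      & forall g' : laurent2 k -> W,
          linear g' -> (forall u v, g' (tens u v) = f u v) -> g' = g].
Proof.
move=> fl fr.
pose g (x : laurent2 k) : W :=
  \sum_(p \in [set: int * int]) mcoeff p x *: f (e p.1) (e p.2).
have glin : linear g.
  apply: fsum_coeff_linear => [p a x y|u]; first exact: coefP.
  exact: finite_coef.
have gE i j : g (mkmalgU (i, j) 1) = f (e i) (e j).
  rewrite /g (@fsum_delta _ _ _ _ _ (i, j)) // => p.
  by rewrite mcoeffU eq_sym.
exists g; split=> // [u v|g' g'lin g'E].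
  have flin1 (a : k) (x y z : V) : f (a *: x + y) z = a *: f x z + f y z.
    exact: fl.
  have gt1 : linear (fun x => g (tens x v)).
    by move=> a x y; rewrite tens_linearl glin.
  rewrite (lin_coef u gt1) (lin_coef u (fl v)).
  apply: eq_fsbigr => i _; congr (_ *: _); rewrite -/(e i).
  have gt2 : linear (fun x => g (tens (e i) x)).
    by move=> a x y; rewrite tens_linearr glin.
  rewrite (lin_coef v gt2) (lin_coef v (fr (e i))).
  by apply: eq_fsbigr => j _; rewrite -/(e j) tens_e gE.
apply/funext => x; rewrite (lin_coef x g'lin) (lin_coef x glin).
by apply: eq_fsbigr => -[i j] _; rewrite gE -g'E tens_e.
Qed.

(* The matrix unit E_{ij} of End(V). *)
Definition munit (i j : int) : V -> V := fun v => mcoeff j v *: e i.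

Lemma munit_e i j m : munit i j (e m) = (j == m)%:R *: e i.
Proof. by rewrite /munit coef_e. Qed.

Definition finitary_pred : {pred V -> V} := fun f =>
  `[< exists s : seq (k * (int * int)),
        f = \sum_(x <- s) x.1 *: munit x.2.1 x.2.2 >].

Fact finitary_submod : submod_closed finitary_pred.
Proof.
split=> [|a f g /asboolP[s ->] /asboolP[r ->]]; apply/asboolP.
  by exists [::]; rewrite big_nil.
exists ([seq (a * x.1, x.2) | x <- s] ++ r).
rewrite [RHS]big_cat.
congr (_ + _).
rewrite [RHS]big_map.
rewrite [LHS]scaler_sumr.
by apply: eq_bigr => x _; rewrite scalerA.
Qed.
HB.instance Definition _ :=
  GRing.isSubmodClosed.Build k (V -> V) finitary_pred finitary_submod.

(* I_Z, the span of the matrix units. *)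
Record finitary := Finitary {
  finitary_fun :> V -> V; _ : finitary_fun \in finitary_pred }.
HB.instance Definition _ := [isSub for finitary_fun].
HB.instance Definition _ := [Choice of finitary by <:].
HB.instance Definition _ := [SubChoice_isSubLmodule of finitary by <:].

(* The (i, j) entry of the matrix of f in the basis (e_n) is mcoeff i (f (e j)). *)
Definition rcf_pred : {pred V -> V} := fun f =>
  `[< [/\ linear f,
          forall i, finite_set [set j | mcoeff i (f (e j)) != 0]
        & forall j, finite_set [set i | mcoeff i (f (e j)) != 0]] >].

Fact rcf_submod : submod_closed rcf_pred.
Proof.
split=> [|a f g /asboolP[fl fi fj] /asboolP[gl gi gj]]; apply/asboolP.
  have z0 i j : ~~ (mcoeff i ((0 : V -> V) (e j)) != 0).
    by rewrite negbK mcoeff0.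
  split=> [a x y|i|j]; first by rewrite /= scaler0 addr0.
    by apply: (@sub_finite_set _ _ set0) => // j /=; rewrite (negbTE (z0 i j)).
  by apply: (@sub_finite_set _ _ set0) => // i /=; rewrite (negbTE (z0 i j)).
have fgE x : (a *: f + g) x = a *: f x + g x by [].
have fg0 i j : mcoeff i ((a *: f + g) (e j)) != 0 ->
    mcoeff i (f (e j)) != 0 \/ mcoeff i (g (e j)) != 0.
  rewrite fgE coefP; have [->|] := eqVneq (mcoeff i (f (e j))) 0; last by left.
  by rewrite mulr0 add0r; right.
split.
- move=> b x y; rewrite !fgE fl gl !scalerDr !scalerA (mulrC b).
  by rewrite addrACA.
- move=> i; apply: (@sub_finite_set _ _
    ([set j | mcoeff i (f (e j)) != 0] `|` [set j | mcoeff i (g (e j)) != 0])).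
    by move=> j /fg0.
  by rewrite finite_setU; split.
- move=> j; apply: (@sub_finite_set _ _
    ([set i | mcoeff i (f (e j)) != 0] `|` [set i | mcoeff i (g (e j)) != 0])).
    by move=> i /fg0.
  by rewrite finite_setU; split.
Qed.
HB.instance Definition _ :=
  GRing.isSubmodClosed.Build k (V -> V) rcf_pred rcf_submod.

(* End_rcf(V). *)
Record rcf := Rcf { rcf_fun :> V -> V; _ : rcf_fun \in rcf_pred }.
HB.instance Definition _ := [isSub for rcf_fun].
HB.instance Definition _ := [Choice of rcf by <:].
HB.instance Definition _ := [SubChoice_isSubLmodule of rcf by <:].

Fact munit_finitary i j : munit i j \in finitary_pred.
Proof.
by apply/asboolP; exists [:: (1, (i, j))]; rewrite big_seq1 scale1r.
Qed.

Definition E i j : finitary := Finitary (munit_finitary i j).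

(* The values of R_0 on matrix units: pointwise sums of matrix units. *)
Definition R0_unit_fun (i j : int) : V -> V := fun v =>
  if j < i then - \sum_(p \in [set: nat]) E (i - 1 - p%:Z) (j - p%:Z) v
  else \sum_(p \in [set: nat]) E (i + p%:Z) (j + 1 + p%:Z) v.

Lemma finite_R0_unit (a b : nat -> int) (v : V) :
  injective b -> finite_set [set p | munit (a p) (b p) v != 0].
Proof.
move=> binj; apply: (@sub_finite_set _ _ (b @^-1` [set n | mcoeff n v != 0])).
  by move=> p /=; apply: contra_neq => c0; rewrite /munit c0 scale0r.
by apply: finite_preimage (finite_coef v) => p q _ _ /binj.
Qed.

Lemma rcf_munit_sum (a b : nat -> int) : injective a -> injective b ->
  (fun v => \sum_(p \in [set: nat]) munit (a p) (b p) v) \in rcf_pred.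
Proof.
move=> ainj binj; apply/asboolP.
have colE p : \sum_(q \in [set: nat]) munit (a q) (b q) (e (b p)) = e (a p).
  rewrite (@fsum_delta _ _ _ _ _ p) // => q.
  by rewrite coef_e inj_eq.
have col0 j : ~ range b j ->
    \sum_(q \in [set: nat]) munit (a q) (b q) (e j) = 0.
  move=> bj; apply: fsbig1 => q _; rewrite munit_e.
  have [bq|_] := eqVneq (b q) j; last by rewrite scale0r.
  by case: bj; exists q.
split.
- apply: fsum_coeff_linear => [p c x y|u]; first exact: coefP.
  by apply: finite_preimage (finite_coef u) => p q _ _ /binj.
- move=> i; apply: (@sub_finite_set _ _ (b @` (a @^-1` [set i]))).
    move=> j /=; have [[p _ <-]|/col0 ->] := pselect (range b j).
      rewrite colE coef_e => h; exists p => //; apply/eqP; rewrite eq_sym.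
      by apply: contra_neqT h => /negbTE ->.
    by rewrite mcoeff0 eqxx.
  apply: finite_image; apply: finite_preimage (finite_set1 i).
  by move=> p q _ _ /ainj.
- by move=> j; apply: finite_coef.
Qed.

Fact R0_unit_rcf i j : R0_unit_fun i j \in rcf_pred.
Proof.
rewrite /R0_unit_fun; case: (j < i); last first.
  apply: (@rcf_munit_sum (fun p => i + p%:Z) (fun p => j + 1 + p%:Z)) => p q;
  lia.
have : (fun v => \sum_(p \in [set: nat])
    munit (i - 1 - p%:Z) (j - p%:Z) v) \in rcf_pred.
  apply: (@rcf_munit_sum (fun p => i - 1 - p%:Z) (fun p => j - p%:Z)) => p q;
  lia.
by rewrite -rpredN.
Qed.

Definition R0_unit i j : rcf := Rcf (R0_unit_rcf i j).

(* The linear extension of E_{ij} |-> R0_unit i j to I_Z. *)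
Definition R0 (f : finitary) : rcf :=
  \sum_(p \in [set: int * int]) mcoeff p.1 (f (e p.2)) *: R0_unit p.1 p.2.

Lemma finite_R0 (f : finitary) :
  finite_set [set p : int * int | mcoeff p.1 (f (e p.2)) != 0].
Proof.
case: f => f /= /asboolP[s ->].
apply: (@sub_finite_set _ _ [set` [seq x.2 | x <- s]]); last exact: finite_seq.
move=> [i j] /=; apply: contraR => ns; rewrite fct_sumE raddf_sum /=.
rewrite big_seq big1 // => x xs.
rewrite -[(_ *: _) (e j)]/(x.1 *: munit x.2.1 x.2.2 (e j)).
rewrite munit_e !mcoeffZ coef_e.
have [xj|] := eqVneq x.2.2 j; last by rewrite mul0r mulr0.
have [xi|] := eqVneq i x.2.1; last by rewrite !mulr0.
case/negP: ns; apply/mapP; exists x => //.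
by rewrite xi -xj; case: (x.2).
Qed.

Fact R0_linear : linear R0.
Proof.
apply: fsum_coeff_linear => [p a x y|u]; last exact: finite_R0.
exact: coefP.
Qed.
HB.instance Definition _ :=
  GRing.isLinear.Build k finitary rcf *:%R R0 R0_linear.

Lemma R0_E i j : R0 (E i j) = R0_unit i j.
Proof.
rewrite /R0 (@fsum_delta _ _ _ _ _ (i, j)) // => -[m n] /=.
by rewrite munit_e mcoeffZ coef_e -natrM mulnb andbC (eq_sym j).
Qed.

Definition bracket0 (a b : int) : laurent2 k :=
  \sum_(r \in [set: int]) tens (e r) (R0 (E a r) (e b)).

End Basis.

(* Main.v *)
(* In R_0(E_{ar}) at most one matrix unit acts nontrivially on e_b: p = b-r-1   *)
(* when a <= r, p = r-b when r < a. Its image is +/- e_{a+b-1-r}, and p >= 0    *)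
(* cuts r down to the interval between min(a, b) and max(a, b) - 1.           *)
Require Import Defs.
From mathcomp Require Import all_boot all_order all_algebra.
From mathcomp Require Import classical_sets cardinality fsbigop.
From mathcomp.multinomials Require Import monalg.
From mathcomp Require Import zify.

Import Order.TTheory GRing.Theory Num.Theory.

Local Open Scope classical_set_scope.
Local Open Scope ring_scope.

(** Column [b] of [R0 (E k a r)] has at most one nonzero entry, found by solving for [p] in the
    defining series ([R0_E_e]). Requiring [p] to be nonnegative leaves [r] in [[a, b-1]] with sign
    plus, or in [[b, a-1]] with sign minus. At most one of these intervals is nonempty, so the sum
    over [r] is finite, and trichotomy on [a], [b] gives the three cases. *)

Lemma finite_int_itv (a b : int) : finite_set [set j : int | a <= j <= b - 1].
Proof.
(* If [b < a] the interval is empty, so the absolute value does no harm. *)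
apply: (@sub_finite_set _ _ ((fun n : nat => a + n%:Z) @` `I_`|(b - a)%R|%N)).
  by move=> j /= jab; exists `|(j - a)%R|%N; lia.
exact/finite_image/finite_II.
Qed.

Lemma fsumrN (V : zmodType) (I : choiceType) (D : set I) (F : I -> V) :
  finite_set D -> \sum_(i \in D) - F i = - \sum_(i \in D) F i.
Proof. by move=> Dfin; rewrite !(fsbig_finite _ _ Dfin)/= sumrN. Qed.

(** Injectivity of the column index [y] leaves [p] as the only term that sees [e k b]. *)
Lemma fsum_munit_e (k : fieldType) (x y : nat -> int) (b : int) (p : nat) :
  injective y -> y p = b ->
  \sum_(q \in [set: nat]) munit (x q) (y q) (e k b) = e k (x p).
Proof.
move=> yinj <-; rewrite (@fsum_delta _ _ _ _ _ p) // => q.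
by rewrite coef_e inj_eq.
Qed.

Lemma fsum_munit_e0 (k : fieldType) (x y : nat -> int) (b : int) :
  (forall q, y q != b) ->
  \sum_(q \in [set: nat]) munit (x q) (y q) (e k b) = 0.
Proof.
by move=> yb; apply: fsbig1 => q _; rewrite munit_e (negbTE (yb q)) scale0r.
Qed.

Lemma R0_E_e (k : fieldType) (a r b : int) :
  R0 (E k a r) (e k b) =
    if a <= r <= b - 1 then e k (a + b - 1 - r)
    else if b <= r <= a - 1 then - e k (a + b - 1 - r) else 0.
Proof.
rewrite R0_E /= /R0_unit_fun /=; case: ifP => ra.
- rewrite ifF; last by lia.
  case: ifP => rb; last first.
    (* Here [r < b], and the columns [r - p] only move further below [b]. *)
    by rewrite (@fsum_munit_e0 _ (fun p => _) (fun p => r - p%:Z)) ?oppr0 //; lia.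
  rewrite (@fsum_munit_e _ (fun p => a - 1 - p%:Z) (fun p => r - p%:Z) _
            `|(r - b)%R|%N).
  + by congr (- e k _); lia.
  + by move=> p q; lia.
  + by lia.
- case: ifP => rb.
    rewrite (@fsum_munit_e _ (fun p => a + p%:Z) (fun p => r + 1 + p%:Z) _
              `|(b - r - 1)%R|%N).
    + by congr (e k _); lia.
    + by move=> p q; lia.
    + by lia.
  rewrite ifF; last by lia.
  by rewrite (@fsum_munit_e0 _ (fun p => _) (fun p => r + 1 + p%:Z)) //; lia.
Qed.

Lemma tens0r (k : fieldType) (u : laurent k) : tens u 0 = 0.
Proof.
by have := tens_linearr u (-1) 0 0; rewrite !scaleN1r oppr0 addr0 addNr.
Qed.

Lemma tensNr (k : fieldType) (u v : laurent k) : tens u (- v) = - tens u v.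
Proof.
by have := tens_linearr u (-1) v 0; rewrite !scaleN1r tens0r !addr0.
Qed.

Theorem proposition5p2 (k : fieldType) (a b : int) :
  finite_set [set r : int | tens (e k r) (R0 (E k a r) (e k b)) != 0] /\
  bracket0 k a b =
    if a < b then
      \sum_(j \in [set j : int | a <= j <= b - 1])
        tens (e k j) (e k (a + b - 1 - j))
    else if b < a then
      - \sum_(j \in [set j : int | b <= j <= a - 1])
          tens (e k j) (e k (a + b - 1 - j))
    else 0.
Proof.
split.
  apply: (@sub_finite_set _ _ ([set j : int | a <= j <= b - 1] `|`
                               [set j : int | b <= j <= a - 1])).
    move=> r /=; rewrite R0_E_e; case: ifP => [|_]; first by left.
    by case: ifP => [|_]; [right | rewrite tens0r eqxx].
  by rewrite finite_setU; split; apply: finite_int_itv.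
rewrite /bracket0; case: ifP => ab; [|case: ifP => ba].
- transitivity (\sum_(r \in [set j : int | a <= j <= b - 1])
      tens (e k r) (R0 (E k a r) (e k b))).
    (* Off [[a, b-1]] the summand vanishes, since [[b, a-1]] is empty when [a < b]. *)
    apply/esym/fsbig_widen => // r /= [_ /negP/negbTE rab].
    by rewrite R0_E_e rab ifF ?tens0r //; lia.
  by apply: eq_fsbigr => r; rewrite inE /= => rab; rewrite R0_E_e rab.
- transitivity (\sum_(r \in [set j : int | b <= j <= a - 1])
      tens (e k r) (R0 (E k a r) (e k b))).
    apply/esym/fsbig_widen => // r /= [_ /negP/negbTE rba].
    by rewrite R0_E_e rba ifF ?tens0r //; lia.
  rewrite -fsumrN; last exact: finite_int_itv.
  apply: eq_fsbigr => r; rewrite inE /= => rba.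
  by rewrite R0_E_e ifF ?rba ?tensNr //; lia.
(* Now [a = b]: both intervals are empty. *)
- by apply: fsbig1 => r _; rewrite R0_E_e !ifF ?tens0r //; lia.
Qed.
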